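(* Let $\varepsilon>0$ and let $f(t)=A(t)e^{i\phi(t)}$ be an intrinsic-mode type function with accuracy $\varepsilon$. Then $$\|P_{-}f\|_{L^2}^2\le\left(\frac{8\pi^2}{\|A\|_{L^2}^2}\,\frac{\|A'\|_{L^\infty}^2+\varepsilon^2\|A\|_{L^\infty}^2}{\inf_{0<t<2\pi}\phi'(t)}\right)\|f\|_{L^2}^2 .$$
   Context: $\mathbb{T}=\mathbb{R}/2\pi\mathbb{Z}$, and functions on $\mathbb{T}$ are identified with $2\pi$-periodic functions on $\mathbb{R}$; $\mathbb{R}_+=(0,\infty)$. $L^2=L^2(\mathbb{T})$ with $\|g\|_{L^2}^2=\int_0^{2\pi}|g(t)|^2\,dt$, and $L^\infty=L^\infty(\mathbb{T})$. Definition. A periodic, continuous function $f:\mathbb{R}\to\mathbb{C}$ is an intrinsic-mode type (IMT) function with accuracy $\varepsilon>0$ if $f(t)=A(t)e^{i\phi(t)}$ with $A\in C^1(\mathbb{T},\mathbb{R}_+)$, $\phi\in C^2(\mathbb{T},\mathbb{T})$ (so $\phi$ is the class of a $C^2$ real-valued function on $\mathbb{R}$ with $\phi(t+2\pi)-\phi(t)\in2\pi\mathbb{Z}$, and $\phi'$, $\phi''$ are real-valued $2\pi$-periodic functions), $\inf_{t\in\mathbb{R}}\phi'(t)>0$, $\sup_{t\in\mathbb{R}}\phi'(t)<\infty$, and for all $t$ $$|A'(t)|\le\varepsilon\phi'(t),\qquad|\phi''(t)|\le\varepsilon\phi'(t).$$ $P_-$ and $P_+$ denote the orthogonal projections of $L^2(\mathbb{T})$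 onto the negative and nonnegative Fourier frequencies, respectively: if $f=\sum_{n\in\mathbb{Z}}\hat f(n)e^{int}$, then $P_-f=\sum_{n<0}\hat f(n)e^{int}$ and $P_+f=\sum_{n\ge0}\hat f(n)e^{int}$. *)

(* Defs.v *)
(* poly is not imported: its notations for formal derivatives would capture
   f^`() and f^`(n), which here are derivatives of functions R -> R. *)
From HB Require Import structures.
From mathcomp Require Import all_boot all_order ssralg ssrnum ssrint interval.
From mathcomp Require Import complex.
From mathcomp Require Import all_classical all_reals all_analysis.

Set Implicit Arguments.
Unset Strict Implicit.
Unset Printing Implicit Defensive.

Import Order.TTheory GRing.Theory Num.Theory.
Import numFieldNormedType.Exports.

Local Open Scope ring_scope.
Local Open Scope complex_scope.
Local Open Scope classical_set_scope.

Section Defs.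
Context {R : realType}.

Local Notation mu := (@lebesgue_measure R).

Definition Ck (n : nat) (h : R -> R) : Prop :=
  (forall j : nat, (j < n)%N -> forall t : R, derivable h^`(j) t 1) /\
  continuous h^`(n).

Definition expi (x : R) : R[i] := cos x +i* sin x.

(* Functions on the circle R/2piZ are 2pi-periodic functions on R. *)
Definition in_L2 (g : R -> R[i]) : Prop :=
  [/\ periodic g (2 * pi),
      measurable_fun setT (fun t => complex.Re (g t)),
      measurable_fun setT (fun t => complex.Im (g t)) &
      (\int[mu]_(t in `[0%R, (2 * pi)%R]) (Normc.normc (g t) ^+ 2)%:E < +oo)%E].

(* Meaningful for g in L2 only: an infinite integral is sent to 0. *)
Definition L2norm (g : R -> R[i]) : R :=
  Num.sqrt (\int[mu]_(t in `[0, 2 * pi]) (Normc.normc (g t) ^+ 2)).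

(* Essential supremum over R, which for a 2pi-periodic function is that over
   one period; an infinite value is sent to 0. *)
Definition Linfnorm (h : R -> R) : R :=
  fine ('N[mu]_+oo%E[EFin \o h]).

Definition Cintegral (h : R -> R[i]) : R[i] :=
  (\int[mu]_(t in `[0, 2 * pi]) complex.Re (h t)) +i*
  (\int[mu]_(t in `[0, 2 * pi]) complex.Im (h t)).

Definition fourier (f : R -> R[i]) (n : int) : R[i] :=
  (2 * pi)^-1%:C * Cintegral (fun t => f t * expi (- (n%:~R * t))).

(* Partial sum of the Fourier series of f over the frequencies -N, ..., -1. *)
Definition neg_partial_sum (f : R -> R[i]) (N : nat) (t : R) : R[i] :=
  \sum_(1 <= k < N.+1) fourier f (- k%:Z) * expi ((- k%:Z)%:~R * t).

(* g is (a representative of) P_- f: the sum, in the sense of L2 convergence,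
   of the negative-frequency part of the Fourier series of f.  It determines g
   up to almost everywhere equality, and such a g exists for every f in L2 by
   Riesz-Fischer. *)
Definition is_Pminus (f g : R -> R[i]) : Prop :=
  in_L2 g /\
  L2norm (fun t => neg_partial_sum f N t - g t) @[N --> \oo] --> (0 : R).

(* phi is a real-valued lift of the circle-valued phase.  As inf is 0 on sets
   that are not bounded below, 0 < inf also says that the infimum is finite. *)
Definition is_IMT (eps : R) (A phi : R -> R) (f : R -> R[i]) : Prop :=
  [/\ 0 < eps,
      periodic f (2 * pi),
      continuous (fun t => complex.Re (f t)) /\
        continuous (fun t => complex.Im (f t)) &
      forall t, f t = (A t)%:C * expi (phi t)] /\
  [/\ Ck 1 A, periodic A (2 * pi) & forall t, 0 < A t] /\
  [/\ Ck 2 phi,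
      forall t, exists k : int, phi (t + 2 * pi) - phi t = 2 * pi * k%:~R,
      0 < inf (range phi^`()) &
      has_ubound (range phi^`())] /\
  forall t, `|A^`() t| <= eps * phi^`() t /\ `|phi^`(2) t| <= eps * phi^`() t.

End Defs.

(* Main.v *)
Require Import Defs.
From HB Require Import structures.
From mathcomp Require Import all_boot all_order ssralg ssrnum ssrint interval.
From mathcomp Require Import complex.
From mathcomp Require Import all_classical all_reals all_analysis.
From mathcomp Require Import measurable_realfun ess_sup_inf ring lra.

Set Implicit Arguments.
Unset Strict Implicit.
Unset Printing Implicit Defensive.

Import Order.TTheory GRing.Theory Num.Theory.
Import numFieldNormedType.Exports.

Local Open Scope ring_scope.
Local Open Scope complex_scope.
Local Open Scope classical_set_scope.

(** Since |f| = A, the factors ||A||^2 and ||f||^2 of the bound cancel, and what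
    is left to prove is
      ||P_- f||^2 <= 8 pi^2 (b^2 + eps^2 a^2) / m,
    with a = ||A||_oo, b = ||A'||_oo and m = inf phi'.

    The Fourier coefficient of f at the frequency -k is the oscillatory integral
    of A e^{i psi} / (2 pi), where psi(t) = phi(t) + k t.  The phase has no
    stationary point, as psi' = phi' + k >= m + k.  Integrating by parts
    (nonstationary_phase), with no boundary term by periodicity, leaves
    the integral of (A / psi')' e^{i psi}, and
      |(A / psi')'| <= |A'| / psi' + |A| |phi''| / psi'^2 <= (b + eps a) / (m + k)
    because |phi''| <= eps phi' <= eps psi'.  This bounds the real and the
    imaginary part of the coefficient, hence its squared modulus by
    2 (b + eps a)^2 / (m + k)^2 (fourier_neg_IMT).

    The terms 1 / (m + k)^2 are dominated by a telescoping sum with total 1 / m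
    (sum_invr_sqr_le).  Orthogonality of the exponentials then bounds the squared
    norm of every partial sum of P_- f by
      2 pi * 2 (b + eps a)^2 / m <= 8 pi (b^2 + eps^2 a^2) / m,
    and the bound passes to the L2 limit (L2norm_sqr_Pminus_le).  The proof thus
    gives a constant smaller than the stated one by a factor pi. *)

(** * Integrals of continuous functions *)

Section RealAnalysis.
Context {R : realType}.
Local Notation mu := (@lebesgue_measure R).
Implicit Types (a b t : R) (f g F : R -> R).

Lemma continuous_itv_integrable a b f : continuous f ->
  mu.-integrable `[a, b] (EFin \o f).
Proof.
move=> cf; apply: continuous_compact_integrable; first exact: segment_compact.
exact: continuous_subspaceT.
Qed.

Lemma is_derive_continuous F f :
  (forall t : R, is_derive t 1 F (f t)) -> continuous F.
Proof.
move=> dF t; apply: differentiable_continuous; apply/derivable1_diffP.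
exact: (@ex_derive _ _ _ _ _ _ _ (dF t)).
Qed.

Lemma Rintegral_derive a b F f : a < b -> continuous f ->
  (forall t : R, is_derive t 1 F (f t)) ->
  \int[mu]_(t in `[a, b]) f t = F b - F a.
Proof.
move=> ab cf dF; rewrite /Rintegral (@continuous_FTC2 _ _ F)//.
- exact: continuous_subspaceT.
- have cF := is_derive_continuous dF; split.
  + by move=> t _; exact: (@ex_derive _ _ _ _ _ _ _ (dF t)).
  + by apply: cvg_at_right_filter; exact: cF.
  + by apply: cvg_at_left_filter; exact: cF.
- by move=> t _; rewrite derive1E; exact: derive_val.
Qed.

Lemma continuous_sum (I : Type) (r : seq I) (h : I -> R -> R) :
  (forall i, continuous (h i)) -> continuous (fun t => \sum_(i <- r) h i t).
Proof.
move=> ch; elim: r => [|i r ih].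
  by under eq_fun do rewrite big_nil; exact: cst_continuous.
under eq_fun do rewrite big_cons.
by move=> t; apply: cvgD; [exact: ch | exact: ih].
Qed.

Lemma Rintegral_sum (I : Type) (r : seq I) a b (h : I -> R -> R) :
  (forall i, continuous (h i)) ->
  \int[mu]_(t in `[a, b]) (\sum_(i <- r) h i t) =
  \sum_(i <- r) \int[mu]_(t in `[a, b]) h i t.
Proof.
move=> ch; elim: r => [|i r ih].
  under eq_Rintegral do rewrite big_nil.
  by rewrite big_nil Rintegral_cst// mul0r.
rewrite big_cons -ih -RintegralD//.
- by apply: eq_Rintegral => t _; rewrite big_cons.
- exact: continuous_itv_integrable.
- exact/continuous_itv_integrable/continuous_sum.
Qed.

(** A point where the bound fails has a neighbourhood where it fails, of positive
    measure. *)
Lemma continuous_ae_le f (M : R) : continuous f ->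
  {ae mu, forall t, f t <= M} -> forall t, f t <= M.
Proof.
move=> cf aef t; rewrite leNgt; apply/negP => Mft.
have : \forall s \near t, M < f s by exact: (cvgr_gt _ (cf t)).
case/nbhs_ballP => e /= e0 He.
have : mu.-negligible `]t - e, t + e[.
  apply: negligibleS aef => s /= sI.
  apply/negP; rewrite -ltNge; apply: He.
  by rewrite -ball_normE/=; rewrite in_itv/= in sI; rewrite ltr_distlC.
move/negligibleP => /(_ (measurable_itv _)).
rewrite /= lebesgue_measure_itv/= lte_fin ifT; last lra.
by rewrite -EFinB => /eqP; rewrite eqe => /eqP; lra.
Qed.

End RealAnalysis.

(** * The principle of nonstationary phase *)

Section Oscillation.
Context {R : realType}.
Local Notation mu := (@lebesgue_measure R).
Implicit Types (a b t : R).

Lemma continuousMl_cos (A psi : R -> R) :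
  continuous A -> continuous psi -> continuous (fun t => A t * cos (psi t)).
Proof.
move=> cA cpsi t; apply: cvgM; first exact: cA.
by apply: continuous_comp; [exact: cpsi | exact: continuous_cos].
Qed.

Lemma continuousMl_sin (A psi : R -> R) :
  continuous A -> continuous psi -> continuous (fun t => A t * sin (psi t)).
Proof.
move=> cA cpsi t; apply: cvgM; first exact: cA.
by apply: continuous_comp; [exact: cpsi | exact: continuous_sin].
Qed.

(** Write A cos psi = (A / psi1) (sin psi)' and integrate by parts: the boundary
    terms cancel and the integrand left is -(A / psi1)' sin psi, where
    (A / psi1)' = A1 / psi1 - A psi2 / psi1^2.  In the last term one factor psi1 is
    spent on |psi2| <= eps psi1, so that both terms are of order 1 / lambda.  The
    pointwise bounds are stated on the open interval so that the infimum of the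
    phase derivative over an open period can serve as lambda. *)
Lemma nonstationary_phase (A A1 psi psi1 psi2 : R -> R)
    (a b alpha beta eps lambda : R) : a < b -> 0 <= eps -> 0 < lambda ->
  continuous A1 -> continuous psi2 ->
  (forall t : R, is_derive t 1 A (A1 t)) ->
  (forall t : R, is_derive t 1 psi (psi1 t)) ->
  (forall t : R, is_derive t 1 psi1 (psi2 t)) ->
  (forall t, 0 < psi1 t) ->
  A b = A a -> psi1 b = psi1 a -> sin (psi b) = sin (psi a) ->
  (forall t, a < t < b -> [/\ `|A t| <= alpha, `|A1 t| <= beta,
     lambda <= psi1 t & `|psi2 t| <= eps * psi1 t]) ->
  `|\int[mu]_(t in `[a, b]) (A t * cos (psi t))| <=
    (beta + eps * alpha) / lambda * (b - a).
Proof.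
move=> ab eps0 lambda0 cA1 cpsi2 dA dpsi dpsi1 psi1_gt0 Aab psi1ab sinab bnd.
have cA := is_derive_continuous dA.
have cpsi := is_derive_continuous dpsi.
have cpsi1 := is_derive_continuous dpsi1.
have psi1_neq0 t : psi1 t != 0 by rewrite gt_eqF.
have cpsi1V : continuous (fun t => (psi1 t)^-1).
  by move=> t; apply: cvgV => //; exact: cpsi1.
(* q1 is the derivative of q = A / psi1. *)
pose q t := A t * (psi1 t)^-1.
pose q1 t := A1 t * (psi1 t)^-1 - A t * psi2 t * (psi1 t)^-1 * (psi1 t)^-1.
have dq (t : R) : is_derive t 1 q (q1 t).
  have dV := is_deriveV (psi1_neq0 t) (dpsi1 t).
  apply: is_derive_eq (is_deriveM (dA t) dV) _.
  by rewrite /q1 /GRing.scale /=; field.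
have cq1 : continuous q1.
  move=> t; apply: cvgB; first by apply: cvgM; [exact: cA1 | exact: cpsi1V].
  apply: cvgM; last exact: cpsi1V.
  apply: cvgM; last exact: cpsi1V.
  by apply: cvgM; [exact: cA | exact: cpsi2].
have dF (t : R) : is_derive t 1 (fun s => q s * sin (psi s))
    (A t * cos (psi t) + q1 t * sin (psi t)).
  have ds := is_derive1_comp (is_derive_sin (psi t)) (dpsi t).
  apply: is_derive_eq (is_deriveM (dq t) ds) _.
  by rewrite /q /GRing.scale /=; field.
have cAcos := continuousMl_cos cA cpsi.
have cqsin := continuousMl_sin cq1 cpsi.
have := Rintegral_derive ab _ dF.
rewrite /q Aab psi1ab sinab subrr RintegralD//; last 2 first.
- exact: continuous_itv_integrable.
- exact: continuous_itv_integrable.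
move=> /(_ (fun t => cvgD (cAcos t) (cqsin t)))/eqP; rewrite addr_eq0 => /eqP ->.
have iqsin := @continuous_itv_integrable _ a b _ cqsin.
rewrite normrN (le_trans (le_normr_Rintegral _ _))//.
have sub_oo g : mu.-integrable `[a, b] g -> mu.-integrable `]a, b[ g.
  by apply: integrableS => // t; rewrite /= !in_itv/= => /andP[/ltW-> /ltW->].
have sub_oc g : mu.-integrable `[a, b] g -> mu.-integrable `]a, b] g.
  by apply: integrableS => // t; rewrite /= !in_itv/= => /andP[/ltW-> ->].
have inorm : mu.-integrable `[a, b] (EFin \o (fun t => `|q1 t * sin (psi t)|)).
  by apply: continuous_itv_integrable => t; apply: cvg_norm; exact: cqsin.
rewrite -Rintegral_itv_obnd_cbnd; last exact: sub_oc.
rewrite -Rintegral_itv_bndo_bndc; last exact: sub_oo.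
have -> : (beta + eps * alpha) / lambda * (b - a) =
    \int[mu]_(t in `]a, b[) ((beta + eps * alpha) / lambda).
  by rewrite Rintegral_cst//= lebesgue_measure_itv/= lte_fin ab.
apply: le_Rintegral => //; first exact: sub_oo.
  exact/sub_oo/continuous_itv_integrable/cst_continuous.
move=> t; rewrite /= in_itv/= => /bnd[At A1t lt psi2t].
rewrite normrM (@le_trans _ _ `|q1 t|)//.
  by rewrite ler_piMr// ler_norml sin_le1 sin_geN1.
have pt := psi1_gt0 t.
have e1 : `|A1 t| / psi1 t <= beta / lambda.
  apply: ler_pM => //; first by rewrite invr_ge0 ltW.
  by rewrite lef_pV2.
have e2 : `|A t| * (`|psi2 t| / psi1 t) / psi1 t <= alpha * eps / lambda.
  apply: ler_pM => //.
  - by rewrite !mulr_ge0// invr_ge0 ltW.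
  - by rewrite invr_ge0 ltW.
  - apply: ler_pM => //; first by rewrite mulr_ge0// invr_ge0 ltW.
    by rewrite ler_pdivrMr.
  - by rewrite lef_pV2.
rewrite mulrDl (mulrC eps) (le_trans (ler_normB _ _))// lerD//.
  by rewrite normrM normfV (gtr0_norm pt).
by rewrite !normrM normfV (gtr0_norm pt) -(mulrA `|A t|).
Qed.

End Oscillation.

(** * Periodic functions *)

Section Periodic.
Context {R : realType}.
Local Notation mu := (@lebesgue_measure R).
Implicit Types (T t : R) (h : R -> R).

Lemma periodicz (V : zmodType) (h : R -> V) T : periodic h T ->
  forall (n : int) t, h (t + T *~ n) = h t.
Proof.
move=> hT [n|n] t; first exact: periodicn.
by rewrite NegzE mulrNz -(periodicn hT n.+1) -pmulrn subrK.
Qed.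

Lemma periodic_continuous_bounded T h : 0 < T -> continuous h ->
  periodic h T -> exists M : R, forall t, `|h t| <= M.
Proof.
move=> T0 ch hT.
have [|c _ hc] := @EVT_max R (fun t => `|h t|) 0 T (ltW T0).
  by apply: continuous_subspaceT => t; apply: cvg_norm; exact: ch.
exists `|h c| => t.
have /andP[n1 n2] := archimedean.Num.Theory.floor_itv (t / T).
rewrite -(periodicz hT (- archimedean.Num.floor (t / T)) t) hc//.
move: n1 n2; rewrite in_itv/= ler_pdivlMr// ltr_pdivrMr// mulrzDr.
rewrite mulrNz -mulrzl; nra.
Qed.

(** phi (t + T) - phi t is continuous with values in T Z, hence locally constant,
    so its derivative phi1 (t + T) - phi1 t vanishes. *)
Lemma phase_derive_periodic T (phi phi1 : R -> R) : 0 < T ->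
  (forall t, exists k : int, phi (t + T) - phi t = T * k%:~R) ->
  (forall t : R, is_derive t 1 phi (phi1 t)) -> periodic phi1 T.
Proof.
move=> T0 phiT dphi t.
pose g s := phi (s + T) - phi s.
have cphi := is_derive_continuous dphi.
have dg (s : R) : is_derive s 1 g (phi1 (s + T) - phi1 s).
  have ds : is_derive s 1 (fun x : R => x + T) 1.
    by apply: is_derive_eq; rewrite addr0.
  have dc := @is_derive1_comp R phi (fun x => x + T) s _ _ (dphi (s + T)) ds.
  by apply: is_derive_eq (is_deriveB dc (dphi s)) _; rewrite mulr1.
have cg := is_derive_continuous dg.
have gt : \forall s \near t, cst (g t) s = g s.
  have : \forall s \near t, `|g t - g s| < T by by move/cvgrPdist_lt : (cg t); exact.
  apply: filterS => s /=; rewrite /g.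
  have [k ->] := phiT t; have [l ->] := phiT s.
  rewrite -mulrBr -intrB normrM (gtr0_norm T0) gtr_pMr// -intr_norm => kl.
  have : (`|k - l| < 1)%R by rewrite -(ltr_int R).
  rewrite -[1]add0r ltzD1 normr_le0 subr_eq0 => /eqP ->//.
have d0 : is_derive t 1 g 0 by apply: near_eq_is_derive gt _; exact: is_derive_cst.
have := @derive_val _ _ _ _ _ _ _ (dg t).
by rewrite (@derive_val _ _ _ _ _ _ _ d0) => /esym/eqP; rewrite subr_eq0 => /eqP.
Qed.

(** Boundedness makes the essential supremum finite, so that its fine
    part is its value; continuity turns the almost everywhere bound into a pointwise
    one. *)
Lemma le_Linfnorm h : continuous h -> (exists M : R, forall t, `|h t| <= M) ->
  forall t, `|h t| <= Linfnorm h.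
Proof.
move=> ch [M hM].
have muT : (0 < mu setT)%E.
  by rewrite -set_itvNyy lebesgue_measure_itv/= addye// ltry.
pose N : \bar R := ('N[mu]_+oo[EFin \o h])%E.
have nE : N = ess_sup mu (abse \o (EFin \o h)).
  by rewrite /N unlock/= muT.
have n0 : (0 <= N)%E.
  by rewrite nE; apply: ess_sup_gee => //; apply: aeW => t /=.
have nM : (N <= M%:E)%E.
  by rewrite nE; apply/ess_supP; apply: aeW => t /=; rewrite lee_fin.
apply: continuous_ae_le; first by move=> t; apply: cvg_norm; exact: ch.
have := ess_sup_ge mu (abse \o (EFin \o h)).
rewrite -nE; apply: filterS => t /= ht.
rewrite -lee_fin /Linfnorm -/N fineK// fin_numE.
by move: n0 nM; case: (N).
Qed.

End Periodic.

(** * Orthogonality of the exponentials *)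

Section Parseval.
Context {R : realType}.
Local Notation mu := (@lebesgue_measure R).
Local Notation twopi := (2 * pi : R).

Lemma twopi_gt0 : 0 < twopi.
Proof. by rewrite mulr_gt0// pi_gt0. Qed.

Lemma sin_periodic : periodic (@sin R) (2 * pi).
Proof. by move=> x; rewrite mulr_natl sinD2pi. Qed.

Lemma cos_periodic : periodic (@cos R) (2 * pi).
Proof. by move=> x; rewrite mulr_natl cosD2pi. Qed.

Lemma sin_Mint (n : int) : sin (n%:~R * twopi) = 0.
Proof. by rewrite mulrzl -[_ *~ _]add0r (periodicz sin_periodic) sin0. Qed.

Lemma cos_Mint (n : int) : cos (n%:~R * twopi) = 1.
Proof. by rewrite mulrzl -[_ *~ _]add0r (periodicz cos_periodic) cos0. Qed.

Lemma is_deriveMl (w t : R) : is_derive t 1 (fun s : R => w * s) w.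
Proof.
by apply: is_derive_eq (is_deriveM (is_derive_cst w t 1) (is_derive_id t 1)) _;
  rewrite /GRing.scale/= mulr0 addr0 mulr1.
Qed.

Lemma Rintegral_cosMint (n : int) :
  \int[mu]_(t in `[0, twopi]) cos (n%:~R * t) = twopi * (n == 0)%:R.
Proof.
have [->|n0] := eqVneq n 0.
  under eq_Rintegral do rewrite mul0r cos0.
  rewrite Rintegral_cst//= lebesgue_measure_itv/= lte_fin twopi_gt0.
  by rewrite oppr0 adde0 mul1r mulr1.
have w0 : (n%:~R : R) != 0 by rewrite intr_eq0.
have dF (t : R) :
    is_derive t 1 (fun t => n%:~R^-1 * sin (n%:~R * t)) (cos (n%:~R * t)).
  have ds := is_derive1_comp (is_derive_sin (n%:~R * t)) (is_deriveMl _ t).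
  apply: is_derive_eq (is_deriveM (is_derive_cst (n%:~R^-1 : R) t (1 : R)) ds) _.
  by rewrite /GRing.scale/= mulr0 addr0 mulrCA mulVf// mulr1.
rewrite (Rintegral_derive twopi_gt0 _ dF).
  by rewrite sin_Mint !mulr0 sin0 mulr0 subrr.
move=> t; apply: continuous_comp; last exact: continuous_cos.
exact: (is_derive_continuous (is_deriveMl _)).
Qed.

Lemma Rintegral_sinMint (n : int) :
  \int[mu]_(t in `[0, twopi]) sin (n%:~R * t) = 0.
Proof.
have [->|n0] := eqVneq n 0.
  by under eq_Rintegral do rewrite mul0r sin0; rewrite Rintegral_cst// mul0r.
have w0 : (n%:~R : R) != 0 by rewrite intr_eq0.
have dF (t : R) :
    is_derive t 1 (fun t => - n%:~R^-1 * cos (n%:~R * t)) (sin (n%:~R * t)).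
  have ds := is_derive1_comp (is_derive_cos (n%:~R * t)) (is_deriveMl _ t).
  apply: is_derive_eq (is_deriveM (is_derive_cst (- n%:~R^-1 : R) t (1 : R)) ds) _.
  by rewrite /GRing.scale/= mulr0 addr0 mulNr mulNr mulrN opprK mulrCA mulVf// mulr1.
rewrite (Rintegral_derive twopi_gt0 _ dF).
  by rewrite cos_Mint !mulr0 cos0 subrr.
move=> t; apply: continuous_comp; last exact: continuous_sin.
exact: (is_derive_continuous (is_deriveMl _)).
Qed.

Lemma sqr_normc_Re_Im (z : R[i]) :
  Normc.normc z ^+ 2 = complex.Re z ^+ 2 + complex.Im z ^+ 2.
Proof. by case: z => x y; rewrite sqr_sqrtr// addr_ge0// sqr_ge0. Qed.

Definition trig_poly (r : seq int) (c : int -> R[i]) (t : R) : R[i] :=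
  \sum_(n <- r) c n * expi (n%:~R * t).

Lemma Re_trig_poly r c t : complex.Re (trig_poly r c t) = \sum_(n <- r)
  (complex.Re (c n) * cos (n%:~R * t) - complex.Im (c n) * sin (n%:~R * t)).
Proof.
rewrite /trig_poly; elim: r => [|n r ih]; first by rewrite !big_nil.
by rewrite !big_cons -ih; case: (c n) => x y; case: (\sum_(_ <- _) _).
Qed.

Lemma Im_trig_poly r c t : complex.Im (trig_poly r c t) = \sum_(n <- r)
  (complex.Re (c n) * sin (n%:~R * t) + complex.Im (c n) * cos (n%:~R * t)).
Proof.
rewrite /trig_poly; elim: r => [|n r ih]; first by rewrite !big_nil.
by rewrite !big_cons -ih; case: (c n) => x y; case: (\sum_(_ <- _) _).
Qed.

Let continuous_cos_lin (a w : R) : continuous (fun t => a * cos (w * t)).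
Proof.
apply: continuousMl_cos; first exact: cst_continuous.
exact: (is_derive_continuous (is_deriveMl _)).
Qed.

Let continuous_sin_lin (a w : R) : continuous (fun t => a * sin (w * t)).
Proof.
apply: continuousMl_sin; first exact: cst_continuous.
exact: (is_derive_continuous (is_deriveMl _)).
Qed.

Lemma continuous_Re_trig_poly r c :
  continuous (fun t => complex.Re (trig_poly r c t)).
Proof.
under eq_fun do rewrite Re_trig_poly.
by apply: continuous_sum => n t; apply: cvgB;
  [exact: continuous_cos_lin | exact: continuous_sin_lin].
Qed.

Lemma continuous_Im_trig_poly r c :
  continuous (fun t => complex.Im (trig_poly r c t)).
Proof.
under eq_fun do rewrite Im_trig_poly.
by apply: continuous_sum => n t; apply: cvgD;
  [exact: continuous_sin_lin | exact: continuous_cos_lin].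
Qed.

(** The term of indices m, n is the real part of
    conj (c m) (c n) e^{i (n - m) t}. *)
Lemma sqr_normc_trig_poly r c t : Normc.normc (trig_poly r c t) ^+ 2 =
  \sum_(m <- r) \sum_(n <- r)
    ((complex.Re (c m) * complex.Re (c n) + complex.Im (c m) * complex.Im (c n))
       * cos ((m - n)%:~R * t) +
     (complex.Re (c m) * complex.Im (c n) - complex.Im (c m) * complex.Re (c n))
       * sin ((m - n)%:~R * t)).
Proof.
rewrite sqr_normc_Re_Im Re_trig_poly Im_trig_poly !expr2 !big_distrlr/= -big_split/=.
apply: eq_bigr => m _; rewrite -big_split/=; apply: eq_bigr => n _.
have -> : (m - n)%:~R * t = m%:~R * t - n%:~R * t by rewrite intrB mulrBl.
by rewrite cosB sinB; ring.
Qed.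

Let sqr_trig_poly_term (c : int -> R[i]) (m n : int) (t : R) : R :=
  (complex.Re (c m) * complex.Re (c n) + complex.Im (c m) * complex.Im (c n))
    * cos ((m - n)%:~R * t) +
  (complex.Re (c m) * complex.Im (c n) - complex.Im (c m) * complex.Re (c n))
    * sin ((m - n)%:~R * t).

Let continuous_sqr_trig_poly_term c m n : continuous (sqr_trig_poly_term c m n).
Proof.
by move=> t; apply: cvgD; [exact: continuous_cos_lin | exact: continuous_sin_lin].
Qed.

Lemma continuous_sqr_trig_poly r c :
  continuous (fun t => Normc.normc (trig_poly r c t) ^+ 2).
Proof.
under eq_fun do rewrite sqr_normc_trig_poly.
apply: continuous_sum => m; apply: continuous_sum => n.
exact: continuous_sqr_trig_poly_term.
Qed.

Lemma Rintegral_sqr_trig_poly r c : uniq r ->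
  \int[mu]_(t in `[0, twopi]) (Normc.normc (trig_poly r c t) ^+ 2) =
  twopi * \sum_(n <- r) Normc.normc (c n) ^+ 2.
Proof.
move=> ur; under eq_Rintegral do rewrite sqr_normc_trig_poly.
have cterm m n : continuous (sqr_trig_poly_term c m n).
  exact: continuous_sqr_trig_poly_term.
rewrite (@Rintegral_sum _ _ _ _ _
  (fun m t => \sum_(n <- r) sqr_trig_poly_term c m n t)); last first.
  by move=> m; by apply: continuous_sum.
rewrite mulr_sumr big_seq [RHS]big_seq; apply: eq_bigr => m mr.
rewrite (@Rintegral_sum _ _ _ _ _ (sqr_trig_poly_term c m))//.
have term_int n : \int[mu]_(t in `[0, twopi]) sqr_trig_poly_term c m n t =
    (complex.Re (c m) * complex.Re (c n) + complex.Im (c m) * complex.Im (c n))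
      * (twopi * (m == n)%:R).
  rewrite RintegralD//; last 2 first.
  - exact/continuous_itv_integrable/continuous_cos_lin.
  - exact/continuous_itv_integrable/continuous_sin_lin.
  rewrite !RintegralZl//; last 2 first.
  - apply: continuous_itv_integrable => t.
    by have := @continuous_sin_lin 1 (m - n)%:~R t; under eq_fun do rewrite mul1r.
  - apply: continuous_itv_integrable => t.
    by have := @continuous_cos_lin 1 (m - n)%:~R t; under eq_fun do rewrite mul1r.
  by rewrite Rintegral_cosMint Rintegral_sinMint mulr0 addr0 subr_eq0.
rewrite (bigD1_seq m)//= big1 => [|n nm]; rewrite term_int.
  by rewrite eqxx mulr1 addr0 mulrC sqr_normc_Re_Im !expr2.
by rewrite eq_sym (negPf nm) !mulr0.
Qed.

End Parseval.

(** * The projection onto the negative frequencies *)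

Section NegativeFrequencies.
Context {R : realType}.
Local Notation mu := (@lebesgue_measure R).
Local Notation twopi := (2 * pi : R).
Implicit Types (f g : R -> R[i]).

Lemma L2norm_sqr g :
  L2norm g ^+ 2 = \int[mu]_(t in `[0, twopi]) (Normc.normc (g t) ^+ 2).
Proof. by rewrite sqr_sqrtr// Rintegral_ge0// => t _; exact: sqr_ge0. Qed.

Lemma neg_partial_sumE f N : neg_partial_sum f N =
  trig_poly [seq - k%:Z | k <- index_iota 1 N.+1] (fourier f).
Proof. by apply/funext => t; rewrite /trig_poly big_map. Qed.

Lemma L2norm_sqr_neg_partial_sum f N : L2norm (neg_partial_sum f N) ^+ 2 =
  twopi * \sum_(1 <= k < N.+1) Normc.normc (fourier f (- k%:Z)) ^+ 2.
Proof.
rewrite L2norm_sqr neg_partial_sumE Rintegral_sqr_trig_poly ?big_map//.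
by rewrite map_inj_uniq ?iota_uniq// => j k /oppr_inj [].
Qed.

(** The weight delta is small in front of the main term |w|^2 and arbitrarily bad
    in front of the error |w - z|^2: it allows limits in L2 to be taken without
    the triangle inequality of the L2 norm. *)
Lemma sqr_normc_le (delta : R) (z w : R[i]) : 0 < delta ->
  Normc.normc z ^+ 2 <=
    (1 + delta) * Normc.normc w ^+ 2 + (1 + delta^-1) * Normc.normc (w - z) ^+ 2.
Proof.
move=> d0; rewrite !sqr_normc_Re_Im; case: z w => [x y] [u v] /=.
have key (a b : R) : a ^+ 2 <= (1 + delta) * b ^+ 2 + (1 + delta^-1) * (b - a) ^+ 2.
  rewrite -subr_ge0.
  have -> : (1 + delta) * b ^+ 2 + (1 + delta^-1) * (b - a) ^+ 2 - a ^+ 2 =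
      delta^-1 * ((1 + delta) * b - a) ^+ 2.
    by field; rewrite gt_eqF.
  by rewrite mulr_ge0 ?sqr_ge0// invr_ge0 ltW.
rewrite !mulrDr addrACA; exact: lerD.
Qed.

Lemma measurable_sqr_normc g :
  measurable_fun setT (fun t => complex.Re (g t)) ->
  measurable_fun setT (fun t => complex.Im (g t)) ->
  measurable_fun setT (fun t => Normc.normc (g t) ^+ 2).
Proof.
move=> mRe mIm; under eq_fun do rewrite sqr_normc_Re_Im.
by apply: measurable_funD; exact: measurable_funX.
Qed.

Lemma in_L2_integrable g : in_L2 g ->
  mu.-integrable `[0, twopi] (EFin \o (fun t => Normc.normc (g t) ^+ 2)).
Proof.
move=> [_ mRe mIm foo]; apply/integrableP; split.
  apply/measurable_EFinP/(measurable_funS measurableT) => //.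
  exact: measurable_sqr_normc.
by under eq_integral do rewrite /= ger0_norm ?sqr_ge0//.
Qed.

Lemma integrable_lincomb d (T : measurableType d) (nu : {measure set T -> \bar R})
    (D : set T) (a b : R) (u v : T -> R) : measurable D ->
  nu.-integrable D (EFin \o u) -> nu.-integrable D (EFin \o v) ->
  nu.-integrable D (EFin \o (fun t => a * u t + b * v t)).
Proof.
move=> mD iu iv.
exact: (integrableD mD (integrableZl mD a iu) (integrableZl mD b iv)).
Qed.

Lemma Rintegral_lincomb d (T : measurableType d) (nu : {measure set T -> \bar R})
    (D : set T) (a b : R) (u v : T -> R) : measurable D ->
  nu.-integrable D (EFin \o u) -> nu.-integrable D (EFin \o v) ->
  \int[nu]_(t in D) (a * u t + b * v t) =
  a * \int[nu]_(t in D) u t + b * \int[nu]_(t in D) v t.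
Proof.
move=> mD iu iv; rewrite -!RintegralZl// RintegralD//.
- exact: (integrableZl mD a iu).
- exact: (integrableZl mD b iv).
Qed.

(** Let N tend to infinity, then delta to 0, in the integral of sqr_normc_le for
    z = g and w the partial sums. *)
Lemma L2norm_sqr_Pminus_le f g (B : R) : is_Pminus f g ->
  (forall N, L2norm (neg_partial_sum f N) ^+ 2 <= B) -> L2norm g ^+ 2 <= B.
Proof.
move=> [gL2 cvg0] leB.
have ig := in_L2_integrable gL2.
have [_ mReg mImg _] := gL2.
have bound (delta : R) N : 0 < delta -> L2norm g ^+ 2 <= (1 + delta) * B +
    (1 + delta^-1) * L2norm (fun t => neg_partial_sum f N t - g t) ^+ 2.
  move=> d0.
  pose S := neg_partial_sum f N.
  have iS : mu.-integrable `[0, twopi] (EFin \o (fun t => Normc.normc (S t) ^+ 2)).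
    apply: continuous_itv_integrable; rewrite /S neg_partial_sumE.
    exact: continuous_sqr_trig_poly.
  have iSg : mu.-integrable `[0, twopi]
      (EFin \o (fun t => Normc.normc (S t - g t) ^+ 2)).
    have mRe : measurable_fun setT (fun t => complex.Re (S t - g t)).
      under eq_fun do rewrite raddfB/=.
      apply: measurable_funB => //; apply: continuous_measurable_fun.
      by rewrite /S neg_partial_sumE; exact: continuous_Re_trig_poly.
    have mIm : measurable_fun setT (fun t => complex.Im (S t - g t)).
      under eq_fun do rewrite raddfB/=.
      apply: measurable_funB => //; apply: continuous_measurable_fun.
      by rewrite /S neg_partial_sumE; exact: continuous_Im_trig_poly.
    apply: (@le_integrable _ _ _ mu _ _ _
      (EFin \o (fun t =>
        2 * Normc.normc (S t) ^+ 2 + 2 * Normc.normc (g t) ^+ 2))) => //.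
    - apply/measurable_EFinP/(measurable_funS measurableT) => //.
      exact: measurable_sqr_normc.
    - move=> t _; rewrite /= lee_fin !ger0_norm; last 2 first.
      + by rewrite addr_ge0// mulr_ge0// sqr_ge0.
      + exact: sqr_ge0.
      rewrite (le_trans (@sqr_normc_le 1 _ (S t) _))// invr1 lerD//.
      by rewrite opprB addrCA subrr addr0.
    - exact: integrable_lincomb.
  rewrite L2norm_sqr (@le_trans _ _ ((1 + delta) * L2norm S ^+ 2 +
     (1 + delta^-1) * L2norm (fun t => S t - g t) ^+ 2))//; last first.
    rewrite lerD2r ler_pM2l//; first exact: leB.
    by rewrite addr_gt0.
  rewrite !L2norm_sqr -Rintegral_lincomb//.
  apply: le_Rintegral => //.
    exact: integrable_lincomb.
  by move=> t _; exact: sqr_normc_le.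
have B0 : 0 <= B by rewrite (le_trans _ (leB 0%N))// sqr_ge0.
apply/ler_addgt0Pr => e e0.
(* The 1 keeps delta meaningful when B = 0; delta * B <= e is all that matters. *)
pose delta := e / (B + 1).
have d0 : 0 < delta by rewrite divr_gt0// ltr_wpDl.
have cvg_bound : (1 + delta) * B + (1 + delta^-1) *
    L2norm (fun t => neg_partial_sum f N t - g t) ^+ 2 @[N --> \oo]
    --> (1 + delta) * B + (1 + delta^-1) * (0 * 0).
  apply: cvgD; first exact: cvg_cst.
  by apply: cvgM; [exact: cvg_cst | exact: cvgM].
have le_d : L2norm g ^+ 2 <= (1 + delta) * B.
  rewrite 2!mulr0 addr0 in cvg_bound.
  apply: (ler_cvg_to (cvg_cst _) cvg_bound).
  by apply: nearW => N; exact: bound.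
rewrite (le_trans le_d)// mulrDl mul1r lerD2l /delta mulrAC ler_pdivrMr.
  by rewrite ler_pM2l// lerDl.
by rewrite ltr_wpDl.
Qed.

(** As (m + k)^-2 <= (m + k - 1)^-1 - (m + k)^-1, the sum telescopes. *)
Lemma sum_invr_sqr_le (m : R) (N : nat) : 0 < m ->
  \sum_(1 <= k < N.+1) (m + k%:R) ^- 2 <= m^-1.
Proof.
move=> m0; suff : \sum_(1 <= k < N.+1) (m + k%:R) ^- 2 <= m^-1 - (m + N%:R)^-1.
  by move=> h; rewrite (le_trans h)// gerBl invr_ge0 addr_ge0// ltW.
elim: N => [|N ih]; first by rewrite big_geq// addr0 subrr.
rewrite big_nat_recr//= (le_trans (lerD ih (lexx _)))//.
rewrite -addrA lerD2l -natr1; set x : R := m + N%:R.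
have x0 : 0 < x by rewrite ltr_wpDr.
rewrite addrA -/x -subr_ge0.
have -> : - (x + 1)^-1 - (- x^-1 + (x + 1) ^- 2) = x^-1 * (x + 1) ^- 2.
  by field; rewrite !gt_eqF// addr_gt0.
by rewrite mulr_ge0// invr_ge0 ?exprn_ge0// ltW// addr_gt0.
Qed.

End NegativeFrequencies.

(** * Intrinsic-mode type functions *)

Section IntrinsicMode.
Context {R : realType}.
Local Notation mu := (@lebesgue_measure R).
Local Notation twopi := (2 * pi : R).
Implicit Types (eps : R) (A phi : R -> R) (f : R -> R[i]).

Lemma Ck_is_derive n (h : R -> R) j : Ck n h -> (j < n)%N ->
  forall t : R, is_derive t 1 h^`(j) (h^`(j.+1) t).
Proof.
move=> [dh _] jn t; rewrite derive1nS derive1E.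
exact/derivableP/dh.
Qed.

(** The infimum of a set with no lower bound is 0 by convention, so a positive
    value certifies a genuine lower bound. *)
Lemma inf_range_le (h : R -> R) : 0 < inf (range h) -> forall t, inf (range h) <= h t.
Proof.
move=> inf_gt0 t; have [[_ lb]|/inf_out inf0] := pselect (has_inf (range h)).
  by apply: (ge_inf lb); exists t.
by rewrite inf0 ltxx in inf_gt0.
Qed.

Lemma inf_phase_derive_gt0 eps A phi f : is_IMT eps A phi f ->
  0 < inf [set phi^`() t | t in `]0, twopi[].
Proof.
move=> [_ [_ [[_ _ inf_gt0 _] _]]].
apply: (lt_le_trans inf_gt0); apply: lb_le_inf.
  exists (phi^`() pi), pi => //=.
  by rewrite in_itv/= pi_gt0 ltr_pMl ?pi_gt0// ltr1n.
by move=> _ [s _ <-]; exact: inf_range_le.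
Qed.

Lemma L2norm_IMT eps A phi f : is_IMT eps A phi f ->
  L2norm f = L2norm (fun t => (A t)%:C).
Proof.
move=> [[_ _ _ fE] _]; congr Num.sqrt; apply: eq_Rintegral => t _.
by rewrite fE Normc.normcM exprMn [X in _ * X]sqr_normc_Re_Im/= cos2Dsin2 mulr1.
Qed.

(** A continuous positive amplitude is bounded below on a period. *)
Lemma L2norm_amplitude_gt0 eps A phi f : is_IMT eps A phi f ->
  0 < L2norm (fun t => (A t)%:C) ^+ 2.
Proof.
move=> [_ [[CA _ Apos] _]].
have cA : continuous A := is_derive_continuous (@Ck_is_derive 1 A 0 CA isT).
have pi0 := @twopi_gt0 R.
have [c _ Ac] := EVT_min (ltW pi0) (continuous_subspaceT cA).
rewrite L2norm_sqr.
apply: (@lt_le_trans _ _ (\int[mu]_(t in `[0, twopi]) (A c ^+ 2))).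
  rewrite Rintegral_cst//= lebesgue_measure_itv/= lte_fin pi0.
  by rewrite oppr0 adde0 mulr_gt0// exprn_gt0.
under [leRHS]eq_Rintegral do rewrite sqr_normc_Re_Im/= expr0n addr0.
apply: le_Rintegral => //.
- exact/continuous_itv_integrable/cst_continuous.
- by apply: continuous_itv_integrable => t; apply: cvgM; exact: cA.
- by move=> t tI; rewrite lerXn2r ?nnegrE ?(ltW (Apos _))// Ac.
Qed.

(** The phase phi t + k t + theta covers both parts of the coefficient: theta = 0
    gives the real part and theta = - pi / 2, which turns cos into sin, the
    imaginary part. *)
Lemma fourier_neg_IMT eps A phi f (k : nat) : is_IMT eps A phi f ->
  Normc.normc (fourier f (- k%:Z)) ^+ 2 <=
    2 * (Linfnorm A^`() + eps * Linfnorm A) ^+ 2 *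
    (inf [set phi^`() t | t in `]0, twopi[] + k%:R) ^- 2.
Proof.
move=> hf; have [[eps0 _ _ fE] [[CA Aper Apos]
  [[Cphi phi_lift inf_gt0 [M supM]] IMT]]] := hf.
set m := inf [set _ | _ in _].
have dA (t : R) : is_derive t 1 A (A^`() t).
  exact: (@Ck_is_derive 1 A 0 CA isT).
have dphi (t : R) : is_derive t 1 phi (phi^`() t).
  exact: (@Ck_is_derive 2 phi 0 Cphi isT).
have dphi1 (t : R) : is_derive t 1 phi^`() (phi^`(2) t).
  exact: (@Ck_is_derive 2 phi 1 Cphi isT).
have cA1 : continuous A^`() by exact: CA.2.
have cphi2 : continuous phi^`(2) by exact: Cphi.2.
have phi1_ge := inf_range_le inf_gt0.
have phi1_gt0 t : 0 < phi^`() t by exact: lt_le_trans (phi1_ge t).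
have pi0 := @twopi_gt0 R.
have m_le t : 0 < t < twopi -> m <= phi^`() t.
  move=> tI; apply: ge_inf.
    by exists 0 => _ [s _ <-]; rewrite ltW.
  by exists t => //=; rewrite in_itv.
have m_gt0 : 0 < m := inf_phase_derive_gt0 hf.
have lambda0 : 0 < m + k%:R by rewrite ltr_wpDr.
have A_le := le_Linfnorm (is_derive_continuous dA)
  (periodic_continuous_bounded pi0 (is_derive_continuous dA) Aper).
have A1_le : forall t, `|A^`() t| <= Linfnorm A^`().
  apply: le_Linfnorm => //; exists (eps * M) => t.
  rewrite (le_trans (IMT t).1)// ler_pM2l//.
  by apply: supM; exists t.
have phiT : phi^`() twopi = phi^`() 0.
  by rewrite -(phase_derive_periodic pi0 phi_lift dphi 0) add0r.
pose psi theta t := phi t + (k%:R * t + theta).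
have sin_psi theta : sin (psi theta twopi) = sin (psi theta 0).
  have [l phi2pi] := phi_lift 0.
  have -> : psi theta twopi = psi theta 0 + twopi *~ (l + k%:Z).
    rewrite /psi mulr0 add0r -mulrzr intrD.
    by rewrite add0r in phi2pi; move/eqP: phi2pi; rewrite subr_eq => /eqP ->; ring.
  exact: (periodicz sin_periodic).
have int_le theta : `|\int[mu]_(t in `[0, twopi]) (A t * cos (psi theta t))| <=
    (Linfnorm A^`() + eps * Linfnorm A) / (m + k%:R) * (twopi - 0).
  apply: (@nonstationary_phase _ A A^`() (psi theta) (fun t => phi^`() t + k%:R)
    phi^`(2)) => //.
  - exact: ltW.
  - move=> t; apply: is_derive_eq (is_deriveD (dphi t)
      (is_deriveD (is_deriveMl k%:R t) (is_derive_cst theta t 1))) _.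
    by rewrite addr0.
  - move=> t; apply: is_derive_eq (is_deriveD (dphi1 t)
      (is_derive_cst (k%:R : R) t 1)) _.
    by rewrite addr0.
  - by move=> t; rewrite ltr_wpDr.
  - by rewrite -[in LHS](add0r twopi) Aper.
  - by rewrite phiT.
  - move=> t tI; split => //.
    + by rewrite lerD2r m_le.
    + by rewrite (le_trans (IMT t).2)// ler_pM2l// lerDl.
have ReE t : complex.Re (f t * expi (- ((- k%:Z)%:~R * t))) = A t * cos (psi 0 t).
  rewrite fE /expi /psi /= mulrNz mulNr opprK addr0 cosD; simpc; ring.
have ImE t : complex.Im (f t * expi (- ((- k%:Z)%:~R * t))) =
    A t * cos (psi (- (pi / 2)) t).
  rewrite fE /expi /psi /= mulrNz mulNr opprK addrA cosBpihalf sinD; simpc; ring.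
have -> : fourier f (- k%:Z) = twopi^-1%:C *
    ((\int[mu]_(t in `[0, twopi]) (A t * cos (psi 0 t))) +i*
     (\int[mu]_(t in `[0, twopi]) (A t * cos (psi (- (pi / 2)) t)))).
  by congr (_ * (_ +i* _)); apply: eq_Rintegral => t _; [exact: ReE | exact: ImE].
rewrite Normc.normcM exprMn !sqr_normc_Re_Im /= expr0n/= addr0.
set K := Linfnorm A^`() + eps * Linfnorm A in int_le *.
have sqr_le theta :
    (twopi^-1 * \int[mu]_(t in `[0, twopi]) (A t * cos (psi theta t))) ^+ 2 <=
    (K / (m + k%:R)) ^+ 2.
  rewrite -real_normK ?num_real// -[leRHS]real_normK ?num_real// lerXn2r ?nnegrE//.
  rewrite normrM gtr0_norm ?invr_gt0// mulrC ler_pdivrMr//.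
  by rewrite (le_trans (int_le theta))// subr0 ler_pM2r// ler_norm.
rewrite mulrDr -!exprMn (le_trans (lerD (sqr_le _) (sqr_le _)))//.
by rewrite -mulr2n -[leLHS]mulr_natl exprMn exprVn mulrA.
Qed.

End IntrinsicMode.

Theorem theorem1 (R : realType) (eps : R) (A phi : R -> R) (f : R -> R[i])
    (heps : 0 < eps) (hf : is_IMT eps A phi f)
    (Pf : R -> R[i]) (hPf : is_Pminus f Pf) :
  L2norm Pf ^+ 2 <=
    (8 * pi ^+ 2 / L2norm (fun t => (A t)%:C) ^+ 2 *
     ((Linfnorm A^`() ^+ 2 + eps ^+ 2 * Linfnorm A ^+ 2) /
      inf [set phi^`() t | t in `]0, 2 * pi[])) *
    L2norm f ^+ 2.
Proof.
have m_gt0 := inf_phase_derive_gt0 hf.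
rewrite (L2norm_IMT hf).
have A_neq0 := lt0r_neq0 (L2norm_amplitude_gt0 hf).
set m := inf _ in m_gt0 *.
set al := Linfnorm A; set be := Linfnorm A^`().
set a2 := L2norm _ ^+ 2 in A_neq0 *.
have -> : 8 * pi ^+ 2 / a2 * ((be ^+ 2 + eps ^+ 2 * al ^+ 2) / m) * a2 =
    8 * pi ^+ 2 * (be ^+ 2 + eps ^+ 2 * al ^+ 2) / m.
  by field; rewrite A_neq0 gt_eqF.
apply: (L2norm_sqr_Pminus_le hPf) => N.
rewrite L2norm_sqr_neg_partial_sum.
have coef_le : \sum_(1 <= k < N.+1) Normc.normc (fourier f (- k%:Z)) ^+ 2 <=
    2 * (be + eps * al) ^+ 2 / m.
  apply: (@le_trans _ _ (\sum_(1 <= k < N.+1)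
    2 * (be + eps * al) ^+ 2 * (m + k%:R) ^- 2)).
    by apply: ler_sum => k _; exact: fourier_neg_IMT hf.
  by rewrite -mulr_sumr ler_wpM2l ?sum_invr_sqr_le// mulr_ge0// sqr_ge0.
rewrite (le_trans (ler_wpM2l (ltW twopi_gt0) coef_le))//.
rewrite mulrA ler_pM2r ?invr_gt0//.
have sq : (be + eps * al) ^+ 2 <= 2 * (be ^+ 2 + eps ^+ 2 * al ^+ 2).
  rewrite -subr_ge0.
  have -> : 2 * (be ^+ 2 + eps ^+ 2 * al ^+ 2) - (be + eps * al) ^+ 2 =
    (be - eps * al) ^+ 2 by ring.
  exact: sqr_ge0.
have pi2 := @pi_ge2 R.
(* It remains to compare 2 pi * 2 * 2 = 8 pi with 8 pi^2. *)
have s0 : 0 <= be ^+ 2 + eps ^+ 2 * al ^+ 2 by rewrite -exprMn addr_ge0 ?sqr_ge0.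
nra.
Qed.
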